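(* Let $H_3$ be the blue--blue--red path on ordered vertices $v_0,v_1,v_2,v_3$, and let $I(H_3)=\lim_{n\to\infty}\max_{|V(G)|=n}p(H_3,G)$. Let $x_*\in(0,1/4)$ be the unique root in $(0,1/4)$ of $$32x^3-40x^2+13x-1=0,$$ and put $$a_*=\frac{4x_*^2-7x_*+2}{3-8x_*},\qquad \lambda_*=\frac{x_*}{1-a_*},\qquad p_*=F(a_*,x_* ),$$ where $$F(a,x)=(a^2+(1-a)x)(1-a^2-(1-a)x)-a^3(1-a)-(1-a)x^2(1-x).$$ Then $$I(H_3)=p_*.$$ Moreover, equality is attained by a graph sequence: there are $n$-vertex graphs $G_n$ of the form $$G_n=K_{(a_*+o(1))n}\sqcup R_n$$ (disjoint union of a complete graph and a graph $R_n$), where $|V(R_n)|=(1-a_*+o(1))n$ and every vertex of $R_n$ has degree $(x_*+o(1))n$ (equivalently, relative degree $\lambda_*+o(1)$ inside $R_n$), such that $p(H_3,G_n)\to p_*$ as $n\to\infty$.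
   Context: $H_3$ is the red-blue graph on ordered vertices $v_0,v_1,v_2,v_3$ in which the pairs $v_0v_1$ and $v_1v_2$ are blue, the pair $v_2v_3$ is red, and the remaining three pairs are uncolored (unconstrained). For a finite simple graph $G$ on $n$ vertices, $N(H_3,G)$ is the number of injective maps $\phi:\{v_0,v_1,v_2,v_3\}\to V(G)$ such that $\phi(v_0)\phi(v_1)\notin E(G)$, $\phi(v_1)\phi(v_2)\notin E(G)$ and $\phi(v_2)\phi(v_3)\in E(G)$, and $p(H_3,G)=N(H_3,G)/n^4$. The limit defining $I(H_3)$ exists (standard fact). *)

(* Defs.v *)
From mathcomp Require Import all_boot all_order all_algebra.
From mathcomp Require Import all_classical all_reals all_analysis.

Set Implicit Arguments.
Unset Strict Implicit.
Unset Printing Implicit Defensive.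

Import Order.TTheory GRing.Theory Num.Theory.
Import numFieldNormedType.Exports.

Local Open Scope set_scope.
Local Open Scope ring_scope.

Definition edge_set (V : finType) (E : {set {set V}}) : bool :=
  [forall e in E, #|e| == 2%N].

Notation sgraph V := {E : {set {set V}} | edge_set E}.

Section SimpleGraphs.
Variable V : finType.
Implicit Types (G : sgraph V) (u v : V).

(* A singleton [set u] is never an edge, so adj G is irreflexive. *)
Definition adj G u v : bool := [set u; v] \in val G.

Definition deg G v : nat := #|[set u | adj G v u]|.

Lemma complete_subproof : edge_set [set e : {set V} | #|e| == 2%N].
Proof. by apply/forall_inP => e; rewrite inE. Qed.

Definition complete : sgraph V :=
  exist (fun E : {set {set V}} => edge_set E) _ complete_subproof.

End SimpleGraphs.

Section DisjointUnion.
Variables (V W : finType) (G : sgraph V) (H : sgraph W).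

Definition djunion_edges : {set {set V + W}} :=
  [set [set inl u | u in e] | e : {set V} in val G]
  :|: [set [set inr w | w in e] | e : {set W} in val H].

Lemma djunion_subproof : edge_set djunion_edges.
Proof.
apply/forall_inP => e /setUP[] /imsetP[f fE ->]; rewrite card_imset.
- exact: (forall_inP (valP G)).
- exact: inl_inj.
- exact: (forall_inP (valP H)).
- exact: inr_inj.
Qed.

Definition djunion : sgraph (V + W)%type :=
  exist (fun E : {set {set V + W}} => edge_set E) _ djunion_subproof.

End DisjointUnion.

(* The two lists contain one ordered representative of each red, resp. blue,
   pair of vertices; pairs in neither list are unconstrained. *)
Record redblue (k : nat) := RedBlue {
  red : seq ('I_k * 'I_k);
  blue : seq ('I_k * 'I_k) }.

Definition H3 : redblue 4 :=
  let v (i : nat) : 'I_4 := inord i in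
  RedBlue [:: (v 2%N, v 3%N)] [:: (v 0%N, v 1%N); (v 1%N, v 2%N)].

Definition copies k (H : redblue k) (V : finType) (G : sgraph V) : nat :=
  #|[set phi : {ffun 'I_k -> V} |
      [&& injectiveb phi,
          all (fun e => adj G (phi e.1) (phi e.2)) (red H) &
          all (fun e => ~~ adj G (phi e.1) (phi e.2)) (blue H)]]|.

Definition density (R : realType) k (H : redblue k) (V : finType)
    (G : sgraph V) : R :=
  (copies H G)%:R / #|V|%:R ^+ k.

(* Densities are nonnegative, so the base value 0 does not affect the max. *)
Definition max_density (R : realType) k (H : redblue k) (n : nat) : R :=
  \big[Num.max/0]_(G : sgraph 'I_n) density R H G.

Definition inducibility (R : realType) k (H : redblue k) : R :=
  limn (max_density R H).

Definition F (R : realType) (a x : R) : R :=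
  (a ^+ 2 + (1 - a) * x) * (1 - a ^+ 2 - (1 - a) * x)
  - a ^+ 3 * (1 - a) - (1 - a) * x ^+ 2 * (1 - x).

Definition cubic_root (R : realType) (x : R) : Prop :=
  0 < x < 1 / 4 /\ 32 * x ^+ 3 - 40 * x ^+ 2 + 13 * x - 1 = 0.

(* Main.v *)
Require Import Defs.
From mathcomp Require Import all_boot all_order all_algebra.
From mathcomp Require Import all_classical all_reals all_analysis.
From mathcomp Require Import ring lra zify.

Set Implicit Arguments.
Unset Strict Implicit.
Unset Printing Implicit Defensive.

Import Order.TTheory GRing.Theory Num.Theory.
Import numFieldNormedType.Exports.

Local Open Scope ring_scope.

(** Maximizing the density of the blue-blue-red path.

    For given [v1 = y] and [v2 = z] the choices of [v0] and [v3] are independent,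
    so a graph with relative degrees [d] contains, up to an error of order
    [1/n], the density
    [bbr = mean_y mean_z (1 - d y) (1 - W y z) d z
         = D (1 - D) - mean d^2 + mean mean W(y,z) d(y) d(z)]
    of copies, where [W] is the adjacency matrix and [D] the mean of [d]; for
    every graph this is an upper bound, since dropping injectivity only adds
    maps.  So the upper bound [I(H_3) <= p] is an inequality for one function
    of a symmetric matrix with entries in [[0, 1]].

    Upper bound.  Fix a threshold [s].  Replacing [d] by [d - s] in the last
    term of [bbr] costs only terms in [D] and [mean d^2].  In
    [mean mean W (d - s) (d' - s)] mixed pairs (one degree above [s], one below)
    contribute at most 0, pairs above [s] contribute at most what they would
    with [W = 1], and pairs below [s] are controlled by the arithmetic-geometric
    inequality ([split_path]).  All three estimates are equalities for a clique
    of vertices of degree above [s] next to a regular graph of degree below [s],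
    which is the shape of the optimum.  What remains depends only on the degree
    distribution, is quadratic in the two global quantities [D] and
    [w = mean of the positive part of d - s], and otherwise is a sum over
    vertices.  Expanding around the optimum, all linear terms vanish exactly
    when [a] and [x] are stationary for [F] and [s = a - gap]
    ([tangent_bound]), so that, with [D0] and [w0] the values at the optimum,
    [bbr <= p - (1-2s) mean_high (d-a)^2 - (1-2x-s) mean_low (d-x)^2
             - (D - D0)^2 + (w - w0)^2].
    The only term with the wrong sign is [(w - w0)^2].  After Cauchy--Schwarz in
    each of the two families, the correction is a quadratic form in three
    deviations whose coefficients depend on the proportion [m] of high degrees;
    it is nonnegative for every [m] in [[0, 1]] ([deviation_form_ge0]), and the
    bound [bbr <= p] follows ([bbr_le]).

    Lower bound.  On [k] vertices the graph joining [i] to [j] when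
    [(i + j) mod k < r] has all degrees equal to [r] or [r - 1].  The disjoint
    union of a clique on about [a n] vertices with such a graph of degree about
    [x n] has density at least [p - o(1)] by direct counting
    ([homs_union_ge]). *)

(** * The root of the cubic *)
Section CubicRoot.
Variable R : realType.
Implicit Types x y : R.

(** The three roots sum to 5/4, so if two of them lie in (0, 1/4) the third
    exceeds 3/4; factoring the cubic [f] over its roots would then give
    [f(1/4) < 0], whereas [f(1/4) = 1/4]. *)
Lemma cubic_root_unique x y : cubic_root x -> cubic_root y -> x = y.
Proof.
move=> [/andP[x0 x4] fx] [/andP[y0 y4] fy].
apply/eqP; rewrite -subr_eq0; apply: contraT => xy.
have q : 32 * (x ^+ 2 + x * y + y ^+ 2) - 40 * (x + y) + 13 = 0.
  apply: (mulfI xy); rewrite mulr0.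
  transitivity ((32 * x ^+ 3 - 40 * x ^+ 2 + 13 * x - 1)
    - (32 * y ^+ 3 - 40 * y ^+ 2 + 13 * y - 1)); first by ring.
  by rewrite fx fy subrr.
(* [1/4 - z = -(1 - x - y)] for the third root [z = 5/4 - x - y]. *)
have : 0 < (1/4 - x) * (1/4 - y) * (1 - x - y).
  by rewrite !mulr_gt0 ?subr_gt0//; lra.
suff : (1/4 : R) = (32 * x ^+ 3 - 40 * x ^+ 2 + 13 * x - 1)
  + (1/4 - x) * (32 * (x ^+ 2 + x * y + y ^+ 2) - 40 * (x + y) + 13)
  - 32 * ((1/4 - x) * (1/4 - y) * (1 - x - y)).
  rewrite fx q; lra.
by field.
Qed.

Lemma cubic_root_exists : exists x, cubic_root x.
Proof.
pose f : {poly R} := 32%:P * 'X^3 - 40%:P * 'X^2 + 13%:P * 'X - 1.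
have fE x : f.[x] = 32 * x ^+ 3 - 40 * x ^+ 2 + 13 * x - 1.
  by rewrite /f !hornerE.
have : f.[0] <= 0 <= f.[1/4] by rewrite !fE; apply/andP; split; lra.
case/(@poly_ivt _ f 0 (1/4)) => [|x]; first lra.
move=> /andP[x0 x4] /eqP; rewrite fE => fx.
exists x; split=> //; rewrite !lt_neqAle x0 x4 !andbT.
apply/andP; split; apply/eqP => e; move: fx; first by rewrite -e; lra.
rewrite e; lra.
Qed.

(** All numerical estimates of the constants below are derived from this
    enclosure; its endpoints are continued fraction approximations of the root. *)
Lemma cubic_root_bounds x : cubic_root x -> 12/107 < x < 35/312.
Proof.
move=> [/andP[x0 x4] fx]; apply/andP; split; rewrite ltNge; apply/negP => h.
  have : 0 <= (12/107 - x) * (32 * x^+2 - 36 * x + 8).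
    by apply: mulr_ge0; [lra|nra].
  nra.
have : 0 <= (x - 35/312) * (1/4 - x) * (29 - 32 * x).
  by rewrite !mulr_ge0 //; lra.
nra.
Qed.
End CubicRoot.

(** * The constants of the extremal configuration *)
Section Constants.
Variables (R : rcfType) (x : R).
Hypothesis fx : 32 * x ^+ 3 - 40 * x ^+ 2 + 13 * x - 1 = 0.
Hypothesis xb : 12/107 < x < 35/312.
Definition clique_frac := (4 * x ^+ 2 - 7 * x + 2) / (3 - 8 * x).
Local Notation a := clique_frac.
Let c := 2 * x - 3 * x ^+ 2.

Lemma clique_frac_eq : a * (3 - 8 * x) = 4 * x ^+ 2 - 7 * x + 2.
Proof. by rewrite /clique_frac divfK//; apply/eqP => h; move/andP: xb => []; lra. Qed.

Lemma clique_frac_bounds : 74/123 < a < 68/113.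
Proof.
move/andP: xb => [x1 x2]; have := clique_frac_eq => e.
apply/andP; split; nra.
Qed.

(** The vanishing of the derivative of [F a] at [x], divided by [1 - a]: the
    left-hand side is [1 - 2 D] at the optimum. *)
Lemma light_stationary : 1 - 2 * (a ^+ 2 + (1 - a) * x) = c.
Proof.
have e := clique_frac_eq; rewrite /c.
have n0 : (3 - 8 * x) ^+ 2 != 0.
  rewrite expf_neq0//; apply/eqP => h; move/andP: xb => []; lra.
apply: (mulfI n0); apply/eqP; rewrite -subr_eq0; apply/eqP.
transitivity ((3 - 8 * x) ^+ 2 * (1 - 2 * x - c)
  - 2 * (a * (3 - 8 * x)) ^+ 2 + 2 * x * (a * (3 - 8 * x)) * (3 - 8 * x)).
  by rewrite /c; ring.
rewrite e /c.
(* Clearing the denominators of [a] leaves a multiple of the cubic. *)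
pose f := 32 * x ^+ 3 - 40 * x ^+ 2 + 13 * x - 1.
transitivity (f * (3 * x - 1)); last by rewrite /f fx mul0r.
by rewrite /f; ring.
Qed.

(** The vanishing of the derivative of [F] in its first argument, simplified
    by [light_stationary]. *)
Lemma clique_stationary : 4 * a ^+ 3 - 3 * a ^+ 2 + 2 * a * c - x ^+ 2 + 2 * x ^+ 3 = 0.
Proof.
have e := clique_frac_eq; rewrite /c.
have n0 : (3 - 8 * x) ^+ 3 != 0.
  rewrite expf_neq0//; apply/eqP => h; move/andP: xb => []; lra.
apply: (mulfI n0); rewrite mulr0.
transitivity (4 * (a * (3 - 8 * x)) ^+ 3
  - 3 * (a * (3 - 8 * x)) ^+ 2 * (3 - 8 * x)
  + 2 * (a * (3 - 8 * x)) * (3 - 8 * x) ^+ 2 * c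
  + (3 - 8 * x) ^+ 3 * (2 * x ^+ 3 - x ^+ 2)).
  by rewrite /c; ring.
rewrite e /c.
pose f := 32 * x ^+ 3 - 40 * x ^+ 2 + 13 * x - 1.
transitivity (f * (4 - 32 * x + 84 * x ^+ 2 - 72 * x ^+ 3)).
  by rewrite /f; ring.
by rewrite /f fx mul0r.
Qed.

(** The threshold separating high from low degrees will be [a - gap]; requiring
    that the heavy case of [tangent_bound] be tight at degree [a] makes [gap] a
    root of a quadratic equation. *)
Definition gap := Num.sqrt (3 * a ^+ 2 - 2 * a + (2 * x - 3 * x ^+ 2)).
Local Notation b := gap.

Lemma gap_sqr_bounds : (31/118) ^+ 2 < 3 * a ^+ 2 - 2 * a + c < (29/110) ^+ 2.
Proof.
move/andP: clique_frac_bounds => [a1 a2]; move/andP: xb => [x1 x2].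
have A1 := sqr_ge0 (a - 74/123); have X1 := sqr_ge0 (x - 12/107).
have A2 : 0 <= (a - 74/123) * (68/113 - a) by apply: mulr_ge0; lra.
have X2 : 0 <= (x - 12/107) * (35/312 - x) by apply: mulr_ge0; lra.
by rewrite /c; apply/andP; split; lra.
Qed.

Lemma gap_sqr : b ^+ 2 = 3 * a ^+ 2 - 2 * a + c.
Proof.
rewrite sqr_sqrtr//; move/andP: gap_sqr_bounds => [h _].
by rewrite (le_trans _ (ltW h))// sqr_ge0.
Qed.

Lemma gap_bounds : 31/118 < b < 29/110.
Proof.
have b0 : 0 <= b by exact: sqrtr_ge0.
move: gap_sqr_bounds; rewrite -gap_sqr !ltr_pXn2r// nnegrE; lra.
Qed.

End Constants.

(** * A quadratic form in the deviations from the optimum *)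
Section DeviationForm.
Variable R : realFieldType.
Implicit Types k s r B t u m : R.

(** The determinant condition for the form of [deviation_form_normalized].  It
    looks cubic in [m], but the cubic terms cancel and the coefficient [q] of
    [m^2] is tiny, so it is an interpolation between its values [f0] and [f1]
    at [m = 0] and [m = 1] with a small error.  The values 0.436 and 0.321 are
    just below [1 - 2x - s] and [1 - 2s] at the optimum, and the interval for
    [r] encloses [gap / (a - x)]. *)
Lemma deviation_det_gt0 r m (k := 436/1000 : R) (s := 321/1000 : R) :
  536/1000 < r < 539/1000 -> 0 <= m <= 1 ->
  0 < (k - (k + 1 - m) * r ^+ 2) * ((k + 1) * s - (1 + s) * m + m ^+ 2)
   - m * (k - (k + 1 - m) * r) ^+ 2.
Proof.
move=> /andP[r1 r2] /andP[m0 m1].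
have rr : 0 <= (r - 536/1000) * (539/1000 - r) by apply: mulr_ge0; lra.
have rr' := sqr_ge0 (r - 536/1000).
pose f0 := (k - (k + 1) * r ^+ 2) * ((k + 1) * s).
pose f1 := k ^+ 2 * ((1 - r ^+ 2) * s - (1 - r) ^+ 2).
pose q := k - (k + 1) * r ^+ 2 - r ^+ 2 * (1 + s) - 2 * (k - (k + 1) * r) * r.
have f0p : 5/1000 < f0 by rewrite /f0 /k /s; lra.
have f1p : 1/1000 < f1 by rewrite /f1 /k /s; lra.
have qf : q < 5/1000 by rewrite /q /k /s; lra.
have -> : (k - (k + 1 - m) * r ^+ 2) * ((k + 1) * s - (1 + s) * m + m ^+ 2)
   - m * (k - (k + 1 - m) * r) ^+ 2 = (1 - m) * f0 + m * f1 - q * (m * (1 - m)).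
  by rewrite /f0 /f1 /q; ring.
clearbody f0 f1 q; clear rr rr'; clearbody k s.
have mm : 0 <= m * (1 - m) by apply: mulr_ge0; lra.
have : q * (m * (1 - m)) <= 5/1000 * (m * (1 - m)) by apply: ler_wpM2r => //; lra.
have : 5/1000 * (1 - m) <= (1 - m) * f0 by rewrite mulrC; apply: ler_wpM2l; lra.
have : 1/1000 * m <= m * f1 by rewrite mulrC; apply: ler_wpM2l; lra.
(* What is left, [0.005 (1-m)^2 + 0.001 m > 0], has its minimum at 9/10. *)
have := sqr_ge0 (9/10 - m); lra.
Qed.

(** Completing the square first in [t], after multiplication by [k + 1 - m],
    and then in [u], after multiplication by [C], leaves the determinant as the
    coefficient of [B ^+ 2]. *)
Lemma deviation_form_normalized r m B t u (k := 436/1000 : R) (s := 321/1000 : R) :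
  536/1000 < r < 539/1000 -> 0 <= m <= 1 ->
  (m * B + r * u) ^+ 2 <= s * (m * B ^+ 2) + k * ((1 - m) * t ^+ 2)
    + (m * B + (1 - m) * t + u) ^+ 2.
Proof.
move=> rb mb; have := deviation_det_gt0 rb mb; rewrite -/k -/s.
set C := k - _; set G := _ + m ^+ 2; set E := k - _ => det.
move/andP: rb => [r1 r2]; move/andP: mb => [m0 m1].
have Cp : 0 < C.
  have rr : 0 <= (r - 536/1000) * (539/1000 - r) by apply: mulr_ge0; lra.
  have : 0 <= m * r ^+ 2 by rewrite mulr_ge0 ?sqr_ge0.
  rewrite /C /k; lra.
have kp : 0 < k + 1 - m by rewrite /k; lra.
rewrite -subr_ge0 -(pmulr_rge0 _ kp) -(pmulr_rge0 _ Cp).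
set Q := C * _.
have -> : Q = C * (1 - m) * ((k + 1 - m) * t + (m * B + u)) ^+ 2
   + (C * u + m * E * B) ^+ 2 + m * (C * G - m * E ^+ 2) * B ^+ 2.
  by rewrite /Q /C /G /E; ring.
have C0 := ltW Cp; have G0 := ltW det.
have m1' : 0 <= 1 - m by rewrite subr_ge0.
rewrite addr_ge0//; last by rewrite mulr_ge0 ?sqr_ge0// mulr_ge0.
by rewrite addr_ge0 ?sqr_ge0// mulr_ge0 ?sqr_ge0// mulr_ge0.
Qed.

(** In the application, [m] is the proportion of vertices of high degree, [B]
    and [t] are the deviations of the mean high and mean low degree from [a] and
    [x], and [v = m - a]; the two squared expressions are then [w - w0] and [D - D0].  The
    form is nondecreasing in [k] and [s], and homogeneity in [v] leaves only the
    ratio [b / g]. *)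
Lemma deviation_form_ge0 k s b g m B t v :
  436/1000 <= k -> 321/1000 <= s -> 0 < g -> 536/1000 * g < b < 539/1000 * g ->
  0 <= m <= 1 ->
  (m * B + b * v) ^+ 2 <= s * (m * B ^+ 2) + k * ((1 - m) * t ^+ 2)
    + (m * B + (1 - m) * t + g * v) ^+ 2.
Proof.
move=> kb sb g0 bb mb.
have -> : b * v = (b / g) * (g * v) by rewrite mulrA divfK// gt_eqF.
apply: (le_trans (deviation_form_normalized B t (g * v) _ mb)).
  by rewrite ltr_pdivlMr// ltr_pdivrMr.
move/andP: mb => [m0 m1].
by rewrite lerD2r lerD// ler_wpM2r// mulr_ge0 ?sqr_ge0// subr_ge0.
Qed.
End DeviationForm.

(** * The upper bound for symmetric matrices *)
Section Mean.
Variables (R : realFieldType) (V : finType).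
Implicit Types f g : V -> R.

Definition mean f : R := #|V|%:R^-1 * \sum_v f v.

Lemma eq_mean f g : f =1 g -> mean f = mean g.
Proof. by move=> fg; congr (_ * _); apply: eq_bigr => v _. Qed.

Lemma meanD f g : mean (fun v => f v + g v) = mean f + mean g.
Proof. by rewrite /mean big_split mulrDr. Qed.

Lemma meanZ (k : R) f : mean (fun v => k * f v) = k * mean f.
Proof. by rewrite /mean -mulr_sumr mulrCA. Qed.

Lemma meanB f g : mean (fun v => f v - g v) = mean f - mean g.
Proof. by rewrite /mean sumrB mulrBr. Qed.

Lemma mean_const (k : R) : (0 < #|V|)%N -> mean (fun=> k) = k.
Proof.
by move=> V0; rewrite /mean sumr_const -[k *+ _]mulr_natl mulKf// pnatr_eq0 -lt0n.
Qed.

Lemma ler_mean f g : (forall v, f v <= g v) -> mean f <= mean g.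
Proof.
by move=> fg; rewrite ler_wpM2l ?invr_ge0// ler_sum.
Qed.

Lemma mean_ge0 f : (forall v, 0 <= f v) -> 0 <= mean f.
Proof. by move=> f0; rewrite mulr_ge0 ?invr_ge0// sumr_ge0. Qed.

Lemma exchange_mean (F : V -> V -> R) :
  mean (fun v => mean (F v)) = mean (fun v => mean (F^~ v)).
Proof. by rewrite /mean -!mulr_sumr exchange_big. Qed.

(** Cauchy--Schwarz, from the variance written as a double mean. *)
Lemma mean_sqr_le h f : (forall v, 0 <= h v) ->
  mean (fun v => h v * f v) ^+ 2 <= mean h * mean (fun v => h v * f v ^+ 2).
Proof.
move=> h0.
have : 0 <= mean (fun v => mean (fun u => h v * h u * (f v - f u) ^+ 2)).
  by apply: mean_ge0 => v; apply: mean_ge0 => u; rewrite mulr_ge0 ?sqr_ge0// mulr_ge0.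
have -> : mean (fun v => mean (fun u => h v * h u * (f v - f u) ^+ 2)) =
    mean (fun v => mean h * (h v * f v ^+ 2)
     + (- 2 * mean (fun u => h u * f u)) * (h v * f v)
     + mean (fun u => h u * f u ^+ 2) * h v).
  apply: eq_mean => v.
  transitivity (mean (fun u => (h v * f v ^+ 2) * h u
     + ((- 2 * (h v * f v)) * (h u * f u) + h v * (h u * f u ^+ 2)))).
    by apply: eq_mean => u; ring.
  by rewrite !(meanD, meanZ); ring.
rewrite !(meanD, meanZ) => h1; lra.
Qed.

(** Cauchy--Schwarz in terms of the weighted average [r] of [f]; in this form
    it covers weights of total mass 0, where [r] is arbitrary. *)
Lemma weighted_mean_sqr h f : (forall v, 0 <= h v) ->
  exists r, mean (fun v => h v * f v) = mean h * r /\
            mean h * r ^+ 2 <= mean (fun v => h v * f v ^+ 2).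
Proof.
move=> h0; have := mean_sqr_le f h0.
have : 0 <= mean h by exact: mean_ge0.
rewrite le_eqVlt => /orP[/eqP <- | M0 CS].
  rewrite mul0r => CS; exists 0; rewrite !mul0r; split; last first.
    by apply: mean_ge0 => v; rewrite mulr_ge0 ?sqr_ge0.
  by apply/eqP; rewrite -sqrf_eq0 eq_le CS sqr_ge0.
exists (mean (fun v => h v * f v) / mean h); split.
  by rewrite mulrC divfK// gt_eqF.
rewrite -(ler_pM2l M0) (le_trans _ CS)// le_eqVlt; apply/orP; left.
by apply/eqP; field; rewrite gt_eqF.
Qed.

End Mean.

Section Kernel.
Variables (R : realFieldType) (V : finType) (W : V -> V -> R).
Hypothesis Wsym : forall u v, W u v = W v u.
Hypothesis W01 : forall u v, 0 <= W u v <= 1.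
Hypothesis V0 : (0 < #|V|)%N.

Definition kdeg v := mean (W v).

Local Notation d := kdeg.

(** The probability that, for independent uniform [v0], [v1 = y], [v2 = z] and
    [v3], the pairs of the blue-blue-red path have the prescribed colours. *)
Definition bbr : R :=
  mean (fun y => mean (fun z => (1 - d y) * (1 - W y z) * d z)).

Lemma bbrE : bbr = mean d * (1 - mean d) - mean (fun v => d v ^+ 2)
  + mean (fun v => mean (fun u => W v u * (d v * d u))).
Proof.
have S2 : mean (fun y => mean (fun z => d z * W y z)) =
    mean (fun y => d y ^+ 2).
  rewrite exchange_mean; apply: eq_mean => z; rewrite meanZ expr2.
  by congr (_ * _); apply: eq_mean => y; rewrite Wsym.
transitivity (mean (fun y => (1 - d y) * mean d
   - mean (fun z => d z * W y z) + mean (fun z => W y z * (d y * d z)))).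
  apply: eq_mean => y; rewrite -meanZ -meanB -meanD; apply: eq_mean => z.
  by ring.
rewrite meanD meanB S2; congr (_ - _ + _).
transitivity (mean (fun y => mean d * (1 - d y))).
  by apply: eq_mean => y; rewrite mulrC.
by rewrite meanZ meanB mean_const.
Qed.

(** Moving the origin of the degrees to [s]: the mixed terms are [mean d^2]
    because the degree of a vertex is its row mean. *)
Lemma shift_path (s : R) :
  mean (fun v => mean (fun u => W v u * (d v * d u))) =
  mean (fun v => mean (fun u => W v u * ((d v - s) * (d u - s))))
  + 2 * s * mean (fun v => d v ^+ 2) - s ^+ 2 * mean d.
Proof.
have S1 : mean (fun v => mean (fun u => d v * W v u)) = mean (fun v => d v ^+ 2).
  by apply: eq_mean => v; rewrite meanZ.
have S2 : mean (fun v => mean (fun u => d u * W v u)) = mean (fun v => d v ^+ 2).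
  rewrite exchange_mean -S1; apply: eq_mean => v; apply: eq_mean => u.
  by rewrite Wsym.
transitivity (mean (fun v => mean (fun u => W v u * ((d v - s) * (d u - s))
   + (s * (d v * W v u) + (s * (d u * W v u) + (- s ^+ 2) * W v u))))).
  by apply: eq_mean => v; apply: eq_mean => u; ring.
transitivity (mean (fun v => mean (fun u => W v u * ((d v - s) * (d u - s)))
   + (s * mean (fun u => d v * W v u) + (s * mean (fun u => d u * W v u)
      + (- s ^+ 2) * d v)))).
  by apply: eq_mean => v; rewrite !(meanD, meanZ).
by rewrite !meanD !(meanZ s) (meanZ (- _)) S1 S2; ring.
Qed.

Definition heavy (s : R) v : R := (s <= d v)%R%:R.

(** For an edge between vertices on opposite sides of the threshold the product
    is nonpositive; above the threshold [W <= 1] is used, below it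
    [2 e e' <= e^2 + e'^2].  Equality holds when the heavy vertices form a
    clique, the light ones induce a regular graph, and no edge joins them. *)
Lemma split_path (s : R) :
  mean (fun v => mean (fun u => W v u * ((d v - s) * (d u - s)))) <=
  mean (fun v => heavy s v * (d v - s)) ^+ 2
  + mean (fun v => (1 - heavy s v) * d v * (d v - s) ^+ 2).
Proof.
set h := heavy s.
pose g v := (1 - h v) * (d v - s) ^+ 2.
have pw v u : W v u * ((d v - s) * (d u - s)) <=
    (h v * (d v - s)) * (h u * (d u - s))
    + (1/2 * (g v * W v u) + 1/2 * (g u * W v u)).
  have /andP[w0 w1] := W01 v u; rewrite /g /h /heavy.
  case: (leP s (d v)) => hv; case: (leP s (d u)) => hu /=.
  - have : 0 <= (1 - W v u) * ((d v - s) * (d u - s)).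
      by rewrite !mulr_ge0 ?subr_ge0.
    lra.
  - have : 0 <= W v u * ((d v - s) * (s - d u)).
      by rewrite !mulr_ge0 ?subr_ge0// ltW.
    have : 0 <= W v u * (d u - s) ^+ 2 by rewrite mulr_ge0 ?sqr_ge0.
    lra.
  - have : 0 <= W v u * ((s - d v) * (d u - s)).
      by rewrite !mulr_ge0 ?subr_ge0// ltW.
    have : 0 <= W v u * (d v - s) ^+ 2 by rewrite mulr_ge0 ?sqr_ge0.
    lra.
  - have : 0 <= W v u * (d v - d u) ^+ 2 by rewrite mulr_ge0 ?sqr_ge0.
    lra.
apply: le_trans (ler_mean (fun v => ler_mean (pw v))) _.
have S1 : mean (fun v => mean (fun u => g v * W v u)) = mean (fun v => g v * d v).
  by apply: eq_mean => v; rewrite meanZ.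
have S2 : mean (fun v => mean (fun u => g u * W v u)) = mean (fun v => g v * d v).
  rewrite exchange_mean -S1; apply: eq_mean => v; apply: eq_mean => u.
  by rewrite Wsym.
rewrite le_eqVlt; apply/orP; left; apply/eqP.
transitivity (mean (fun v =>
   mean (fun u => h u * (d u - s)) * (h v * (d v - s))
   + (1/2 * mean (fun u => g v * W v u) + 1/2 * mean (fun u => g u * W v u)))).
  by apply: eq_mean => v; rewrite !(meanD, meanZ); ring.
rewrite !meanD !(meanZ (1/2)) (meanZ (mean _)) S1 S2.
have -> : mean (fun v => (1 - h v) * d v * (d v - s) ^+ 2) = mean (fun v => g v * d v).
  by apply: eq_mean => v; rewrite /g; ring.
by field.
Qed.

(* [a] and [x] are the high and the low degree of the optimum, and [s] the
   threshold between them. *)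
Variables (a x b : R).
Let s := a - b.
Let c := 2 * x - 3 * x ^+ 2.
Hypothesis light_stationary : 1 - 2 * (a ^+ 2 + (1 - a) * x) = c.
Hypothesis clique_stationary : 4 * a ^+ 3 - 3 * a ^+ 2 + 2 * a * c - x ^+ 2 + 2 * x ^+ 3 = 0.
Hypothesis gap_sqr : b ^+ 2 = 3 * a ^+ 2 - 2 * a + c.
Hypothesis sig0 : 0 <= 1 - 2 * s.
Hypothesis kap0 : 0 <= 1 - 2 * x - s.
Hypothesis quad : forall m B t v : R, 0 <= m <= 1 ->
  (m * B + b * v) ^+ 2 <= (1 - 2 * s) * (m * B ^+ 2)
    + (1 - 2 * x - s) * ((1 - m) * t ^+ 2)
    + (m * B + (1 - m) * t + (a - x) * v) ^+ 2.

(** The contribution of a single vertex of degree [y], linearized in the global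
    quantities ([c] is the slope of [D (1 - D)] and [2 a b] that of [w^2] at the
    optimum).  For heavy vertices it is a quadratic in [y] with its maximum
    at [a]; for light ones a cubic with a local maximum at [x].  The hypotheses
    on [b] and [a] say that the first maximum is at [a] and that both have the
    same value, which makes the bound independent of the proportion of heavy
    vertices. *)
Lemma tangent_bound (h : bool) (y : R) : (h -> s <= y) -> (~~ h -> y <= s) ->
  c * y - s ^+ 2 * y - (1 - 2 * s) * y ^+ 2 + (1 - h%:R) * y * (y - s) ^+ 2
    + 2 * (a * b) * (h%:R * (y - s))
  <= x ^+ 2 - 2 * x ^+ 3 - (1 - 2 * s) * (h%:R * (y - a) ^+ 2)
    - (1 - 2 * x - s) * ((1 - h%:R) * (y - x) ^+ 2).
Proof.
have e1 : c = b ^+ 2 - 3 * a ^+ 2 + 2 * a by rewrite gap_sqr; ring.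
case: h => /= hs hs'.
  have e2 : x ^+ 2 - 2 * x ^+ 3 = 4 * a ^+ 3 - 3 * a ^+ 2 + 2 * a * c.
    by apply/eqP; rewrite -subr_eq0 -oppr_eq0 -clique_stationary; apply/eqP; ring.
  rewrite e2 e1 le_eqVlt; apply/orP; left; apply/eqP; rewrite /s; ring.
have : 0 <= (s - y) * (y - x) ^+ 2 by rewrite mulr_ge0 ?sqr_ge0 ?subr_ge0 ?hs'.
rewrite -subr_ge0 => h0; rewrite -subr_ge0.
apply: le_trans h0 _.
by rewrite le_eqVlt; apply/orP; left; apply/eqP; rewrite /c; ring.
Qed.

(** The sum of [tangent_bound] over all vertices, in which the squares
    [(D - D0)^2] and [(w - w0)^2] left over by the linearization are absorbed
    by the assumed nonnegativity of the deviation form. *)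
Lemma bbr_le : bbr <= (a ^+ 2 + (1 - a) * x) * (1 - a ^+ 2 - (1 - a) * x)
  - a ^+ 3 * (1 - a) - (1 - a) * x ^+ 2 * (1 - x).
Proof.
pose h := heavy s.
have h0 v : 0 <= h v by exact: ler0n.
have h1 v : 0 <= 1 - h v by rewrite subr_ge0 /h /heavy lern1 leq_b1.
have [r [Br Xr]] := weighted_mean_sqr (fun v => d v - a) h0.
have [t [Tt Yt]] := weighted_mean_sqr (fun v => d v - x) h1.
set M := mean h in Br Xr.
have M' : mean (fun v => 1 - h v) = 1 - M by rewrite meanB mean_const.
rewrite M' in Tt Yt.
have M0 : 0 <= M <= 1 by rewrite mean_ge0//= -subr_ge0 -M' mean_ge0.
have wE : mean (fun v => h v * (d v - s)) = M * r + b * M.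
  rewrite -Br /M -meanZ -meanD; apply: eq_mean => v; rewrite /s; ring.
have dE : mean d = M * r + a * M + ((1 - M) * t + x * (1 - M)).
  rewrite -Br -Tt -M' /M -!meanZ -!meanD; apply: eq_mean => v; ring.
have tan : c * mean d - s ^+ 2 * mean d
    - (1 - 2 * s) * mean (fun v => d v ^+ 2)
    + mean (fun v => (1 - h v) * d v * (d v - s) ^+ 2)
    + 2 * (a * b) * (M * r + b * M) <= x ^+ 2 - 2 * x ^+ 3
    - (1 - 2 * s) * mean (fun v => h v * (d v - a) ^+ 2)
    - (1 - 2 * x - s) * mean (fun v => (1 - h v) * (d v - x) ^+ 2).
  have hs v : ~~ (s <= d v) -> d v <= s by rewrite -ltNge => /ltW.
  have T := ler_mean (fun v => @tangent_bound (s <= d v) (d v) id (hs v)).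
  rewrite -wE -(mean_const (x ^+ 2 - 2 * x ^+ 3) V0).
  by rewrite -!meanZ -!(meanD, meanB).
have Q := quad r t (M - a) M0.
have X' : (1 - 2 * s) * (M * r ^+ 2) <= (1 - 2 * s) * mean (fun v => h v * (d v - a) ^+ 2).
  by rewrite ler_wpM2l.
have Y' : (1 - 2 * x - s) * ((1 - M) * t ^+ 2) <=
   (1 - 2 * x - s) * mean (fun v => (1 - h v) * (d v - x) ^+ 2).
  by rewrite ler_wpM2l.
have := split_path s; rewrite -/h wE.
rewrite bbrE (shift_path s).
move: dE tan X' Y'.
set D := mean d; set S2 := mean (fun v => d v ^+ 2).
set P := mean (fun v => (1 - h v) * d v * (d v - s) ^+ 2).
set X := mean (fun v => h v * (d v - a) ^+ 2).
set Y := mean (fun v => (1 - h v) * (d v - x) ^+ 2).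
set L := mean (fun v => mean _).
move=> dE tan X' Y' sp.
(* [Ds] and [a * b] are the values of [D] and [w] at the optimum. *)
pose Ds := a ^+ 2 + (1 - a) * x.
have valE : Ds ^+ 2 - a ^+ 2 * b ^+ 2 + (x ^+ 2 - 2 * x ^+ 3) =
  Ds * (1 - a ^+ 2 - (1 - a) * x) - a ^+ 3 * (1 - a) - (1 - a) * x ^+ 2 * (1 - x).
  apply/eqP; rewrite -subr_eq0 gap_sqr; apply/eqP.
  transitivity (- Ds * (1 - 2 * Ds - c)
    - a * (4 * a ^+ 3 - 3 * a ^+ 2 + 2 * a * c - x ^+ 2 + 2 * x ^+ 3)).
    by rewrite /Ds /c; ring.
  by rewrite clique_stationary light_stationary subrr !mulr0 subr0.
rewrite -/Ds -valE.
have sqE : D * (1 - D) - c * D = Ds ^+ 2 - (M * r + (1 - M) * t + (a - x) * (M - a)) ^+ 2.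
  by rewrite -light_stationary -/Ds dE /Ds; ring.
have wsE : (M * r + b * M) ^+ 2 - 2 * (a * b) * (M * r + b * M) =
  (M * r + b * (M - a)) ^+ 2 - a ^+ 2 * b ^+ 2 by ring.
clear - Q X' Y' sp tan sqE wsE.
clearbody D S2 P X Y L Ds.
lra.
Qed.
End Kernel.

(** * Counting copies and maps *)
Section Count.
Variable V : finType.

Lemma card_quadruples (P : V -> V -> V -> V -> bool) :
  #|[set phi : {ffun 'I_4 -> V} |
     P (phi (inord 0)) (phi (inord 1)) (phi (inord 2)) (phi (inord 3))]| =
  (\sum_u \sum_y \sum_z \sum_w P u y z w)%N.
Proof.
rewrite -sum1dep_card big_mkcond /=.
pose mk (q : V * V * (V * V)) : {ffun 'I_4 -> V} :=
  [ffun i : 'I_4 => nth q.1.1 [:: q.1.1; q.1.2; q.2.1; q.2.2] i].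
pose un (phi : {ffun 'I_4 -> V}) :=
  ((phi (inord 0), phi (inord 1)), (phi (inord 2), phi (inord 3))).
have unK : cancel un mk.
  move=> phi; apply/ffunP => i; rewrite ffunE /=.
  case: i => -[|[|[|[|//]]]] lti /=; congr (phi _);
    by apply/val_inj; rewrite /= inordK.
have mkK : cancel mk un.
  by move=> [[u y] [z w]]; rewrite /un !ffunE !inordK.
rewrite (reindex mk) /=; last by exists un => ? _; [exact: mkK|exact: unK].
rewrite (pair_bigA _ (fun u y => (\sum_z \sum_w P u y z w)%N)) /=.
under [RHS]eq_bigr => p _ do rewrite (pair_bigA _ (fun z w => P p.1 p.2 z w : nat)).
rewrite [RHS]pair_bigA /=; apply: eq_bigr => -[[u y] [z w]] _ /=.
by rewrite !ffunE !inordK //=; case: (P _ _ _ _).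
Qed.

Variable G : sgraph V.

Lemma adjC u v : adj G u v = adj G v u.
Proof. by rewrite /adj finset.setUC. Qed.

Lemma degE v : deg G v = (\sum_u adj G v u)%N.
Proof. by rewrite /deg -sum1dep_card big_mkcond; apply: eq_bigr => u _; case: adj. Qed.

(** not nec. injective *)
(** Like [copies], but counting all maps rather than only the injective ones. *)
Definition homs : nat :=
  (\sum_u \sum_y \sum_z \sum_w
    [&& adj G z w, ~~ adj G u y & ~~ adj G y z])%N.

Lemma homsE : homs =
  #|[set phi : {ffun 'I_4 -> V} |
          all (fun e => adj G (phi e.1) (phi e.2)) (red H3) &&
          all (fun e => ~~ adj G (phi e.1) (phi e.2)) (blue H3)]|.
Proof. rewrite /homs -(card_quadruples (fun u y z w =>
  [&& adj G z w, ~~ adj G u y & ~~ adj G y z])).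
by apply: eq_card => phi; rewrite !inE /= !andbT. Qed.

Lemma copies_le_homs : (copies H3 G <= homs)%N.
Proof.
rewrite homsE; apply/subset_leq_card/fintype.subsetP => phi.
by rewrite !inE => /and3P[_ -> ->].
Qed.

(** There are [n^4 - n(n-1)(n-2)(n-3) <= 6 n^3] maps that are not injective. *)
Lemma homs_le_copies : (homs <= copies H3 G + 6 * #|V| ^ 3)%N.
Proof.
pose inj := [set phi : {ffun 'I_4 -> V} | injectiveb phi].
have cI : #|~: inj| = (#|V| ^ 4 - #|V| ^_ 4)%N.
  by rewrite cardsCs finset.setCK card_ffun card_inj_ffuns !card_ord.
have : (#|~: inj| <= 6 * #|V| ^ 3)%N.
  rewrite cI; case: #|V| => [//|[//|[//|n]]].
  rewrite !ffactnS ffactn0 /=. nia.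
move=> cI'; apply: leq_trans (leq_add (leqnn _) cI').
rewrite homsE /copies; set A := [set phi | _]; set B := [set phi | _].
apply: leq_trans (_ : #|B :|: ~: inj| <= _)%N; last by rewrite cardsU leq_subr.
apply/subset_leq_card/fintype.subsetP => phi; rewrite !inE.
by case: (injectiveb phi) => //=; rewrite orbF.
Qed.

(** Given [v1 = y] and [v2 = z], the choices of [v0] and of [v3] are
    independent. *)
Lemma homs_sum (R : realType) : homs%:R =
  \sum_y \sum_z (#|V|%:R - (deg G y)%:R) * (~~ adj G y z)%:R * (deg G z)%:R :> R.
Proof.
rewrite /homs exchange_big /= natr_sum; apply: eq_bigr => y _.
rewrite exchange_big /= natr_sum; apply: eq_bigr => z _.
transitivity (((\sum_u ~~ adj G y u) * ~~ adj G y z * deg G z)%:R : R).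
  congr (_%:R); rewrite degE -mulnA big_distrl /=; apply: eq_bigr => u _.
  rewrite big_distrr big_distrr /=; apply: eq_bigr => w _.
  by rewrite (adjC u y); do !case: adj.
rewrite !natrM; congr (_ * _ * _).
apply/eqP; rewrite eq_sym subr_eq -natrD; apply/eqP; congr (_%:R).
rewrite degE -big_split /= -[LHS]sum1_card; apply: eq_bigr => u _.
by case: adj.
Qed.

End Count.

Section HomPhi.
Variables (R : realType) (V : finType) (G : sgraph V).
Let W (u v : V) : R := (adj G u v)%:R.

Lemma homs_bbr : (0 < #|V|)%N -> (homs G)%:R / #|V|%:R ^+ 4 = bbr W.
Proof.
move=> V0.
have n0 : #|V|%:R != 0 :> R by rewrite pnatr_eq0 -lt0n.
have dE v : kdeg W v = (deg G v)%:R / #|V|%:R.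
  by rewrite /kdeg /mean -natr_sum -degE mulrC.
rewrite homs_sum /bbr /mean.
rewrite mulr_suml mulr_sumr; apply: eq_bigr => y _.
rewrite mulr_suml !mulr_sumr; apply: eq_bigr => z _.
rewrite !dE /W; case: adj => /=; first by rewrite subrr !(mulr0, mul0r).
by field.
Qed.
End HomPhi.

(** * Relabelling, nearly regular graphs and disjoint unions *)
Section Relabel.
Variables (V W : finType) (f : V -> W) (G : sgraph V).
Hypothesis finj : injective f.

Lemma relabel_subproof : edge_set [set f @: e | e : {set V} in val G].
Proof.
apply/forall_inP => e /imsetP[e' Ge' ->]; rewrite card_imset //.
exact: (forall_inP (valP G)).
Qed.

Definition relabel : sgraph W :=
  exist (fun E : {set {set W}} => edge_set E) _ relabel_subproof.

Lemma adj_relabel u v : adj relabel (f u) (f v) = adj G u v.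
Proof.
by rewrite /adj /= -!imset_set1 -imsetU mem_imset//; exact: imset_inj.
Qed.

Lemma copies_relabel k (H : redblue k) : (copies H G <= copies H relabel)%N.
Proof.
pose T (phi : {ffun 'I_k -> V}) : {ffun 'I_k -> W} := [ffun i => f (phi i)].
have Tinj : injective T.
  move=> p q /ffunP pq; apply/ffunP => i.
  by have := pq i; rewrite !ffunE => /finj.
rewrite /copies -(card_imset _ Tinj); apply/subset_leq_card/fintype.subsetP => psi.
move=> /imsetP[phi]; rewrite !inE => /and3P[/injectiveP pinj re bl] ->.
apply/and3P; split.
- by apply/injectiveP => i j; rewrite !ffunE => /finj/pinj.
- by apply/allP => e /(allP re); rewrite !ffunE adj_relabel.
- by apply/allP => e /(allP bl); rewrite !ffunE adj_relabel.
Qed.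

End Relabel.

(** The maximum runs over graphs on ['I_n] only, so a graph on another vertex
    set is first carried over along an enumeration of its vertices. *)
Lemma density_le_max (R : realType) k (H : redblue k) (V : finType) (G : sgraph V) :
  density R H G <= max_density R H #|V|.
Proof.
rewrite /max_density.
have rk : injective (@enum_rank V) by exact: enum_rank_inj.
apply: le_trans (le_bigmax _ _ (relabel G rk)).
by rewrite /density card_ord ler_wpM2r ?invr_ge0 ?exprn_ge0// ler_nat copies_relabel.
Qed.

Section RelGraph.
Variables (V : finType) (e : rel V).
Lemma rel_graph_subproof :
  edge_set [set [set p.1; p.2] | p : V * V in [pred p | (p.1 != p.2) && e p.1 p.2]].
Proof. by apply/forall_inP => s /imsetP[p]; rewrite inE => /andP[pp _] ->; rewrite cards2 pp. Qed.

Definition rel_graph : sgraph V :=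
  exist (fun E : {set {set V}} => edge_set E) _ rel_graph_subproof.

Lemma adj_rel_graph u v : symmetric e -> adj rel_graph u v = (u != v) && e u v.
Proof.
move=> esym; apply/idP/idP => [/imsetP[[x y]]|uv]; last by apply/imsetP; exists (u, v).
rewrite inE /= => /andP[xy exy] uvE.
have : (x \in [set u; v]) && (y \in [set u; v]) by rewrite uvE !inE !eqxx orbT.
rewrite !inE => /andP[/orP[]/eqP xE /orP[]/eqP yE]; move: xy exy; rewrite xE yE ?eqxx//.
  by move=> -> ->.
by rewrite eq_sym esym => -> ->.
Qed.
End RelGraph.

Section SumGraph.
Variables (k r : nat).
(** A nearly regular graph of any prescribed degree: for fixed [i] the residue
    [(i + j) %% k] takes each value once, so exactly [r] values of [j] qualify,
    and at most the loop [j = i] is lost. *)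
Definition sum_graph : sgraph 'I_k := rel_graph (fun i j : 'I_k => (i + j) %% k < r)%N.

Lemma adj_sum_graph i j : adj sum_graph i j = (i != j) && ((i + j) %% k < r)%N.
Proof. by apply: adj_rel_graph => x y; rewrite addnC. Qed.

Lemma deg_sum_graph i : (r <= k)%N -> (r.-1 <= deg sum_graph i <= r)%N.
Proof.
move=> rk; have k0 : (0 < k)%N by apply: leq_ltn_trans (ltn_ord i).
pose g (j : 'I_k) : 'I_k := Ordinal (ltn_pmod (i + j) k0).
have ginj : injective g.
  move=> x y /(congr1 val) /= /eqP; rewrite eqn_modDl !modn_small// => /eqP xy.
  exact: val_inj.
pose A := g @^-1: [set w : 'I_k | (w < r)%N].
have cA : #|A| = r.
  rewrite /A card_preimset// -sum1dep_card.
  rewrite (big_ord_narrow rk).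
  by rewrite sum1_card card_ord.
have dA : [set j | adj sum_graph i j] = A :\ i.
  by apply/setP => j; rewrite !inE adj_sum_graph eq_sym.
rewrite /deg dA -{1 2}cA (cardsD1 i A); case: (i \in A).
  by rewrite add1n /= leqnn leqnSn.
by rewrite add0n leqnn leq_pred.
Qed.
End SumGraph.

Section Union.
Variables (V W : finType) (G : sgraph V) (H : sgraph W).
Lemma adj_djunion_l u v : adj (djunion G H) (inl u) (inl v) = adj G u v.
Proof.
rewrite /adj /= finset.in_setU -!imset_set1 -imsetU mem_imset; last exact/imset_inj/inl_inj.
rewrite orbC; case: imsetP => // -[e _ /setP /(_ (inl u))].
by rewrite mem_imset ?inE ?eqxx; [case/esym/imsetP|exact: inl_inj].
Qed.
Lemma adj_djunion_r u v : adj (djunion G H) (inr u) (inr v) = adj H u v.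
Proof.
rewrite /adj /= finset.in_setU orbC -!imset_set1 -imsetU mem_imset; last exact/imset_inj/inr_inj.
rewrite orbC; case: imsetP => // -[e _ /setP /(_ (inr u))].
by rewrite mem_imset ?inE ?eqxx; [case/esym/imsetP|exact: inr_inj].
Qed.
Lemma adj_djunion_lr u v : adj (djunion G H) (inl u) (inr v) = false.
Proof.
apply/negP => /setUP[] /imsetP[e _ /setP eE].
  by have := eE (inr v); rewrite !inE eqxx => /esym/imsetP[].
by have := eE (inl u); rewrite !inE eqxx => /esym/imsetP[].
Qed.
Lemma adj_djunion_rl u v : adj (djunion G H) (inr u) (inl v) = false.
Proof. by rewrite adjC adj_djunion_lr. Qed.

Lemma deg_djunion_l u : deg (djunion G H) (inl u) = deg G u.
Proof.
rewrite !degE big_sumType /=.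
rewrite [X in (_ + X)%N]big1 ?addn0 => [|v _]; last by rewrite adj_djunion_lr.
by apply: eq_bigr => v _; rewrite adj_djunion_l.
Qed.

Lemma deg_djunion_r u : deg (djunion G H) (inr u) = deg H u.
Proof.
rewrite !degE big_sumType /=.
rewrite [X in (X + _)%N]big1 ?add0n => [|v _]; last by rewrite adj_djunion_rl.
by apply: eq_bigr => v _; rewrite adj_djunion_r.
Qed.
End Union.

Lemma adj_complete (V : finType) (u v : V) : adj (complete V) u v = (u != v).
Proof. by rewrite /adj inE cards2; case: (u == v). Qed.

Lemma deg_complete (V : finType) (u : V) : deg (complete V) u = #|V|.-1.
Proof.
rewrite /deg; have -> : [set v | adj (complete V) u v] = [set~ u].
  by apply/setP => v; rewrite !inE adj_complete eq_sym.
by rewrite cardsC1.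
Qed.

(** The three products count pairs [(v1, v2)] in (clique, sparse part), (sparse
    part, clique) and (sparse part, sparse part).  Using [m.-1] and [r.-1]
    keeps the bound valid when a part or the degree vanishes. *)
Lemma homs_union_ge (R : realType) m k r : (r <= k)%N ->
  m%:R * (k%:R * (k%:R * (r.-1)%:R))
  + k%:R * ((m + k)%:R - r%:R) * (m%:R * (m.-1)%:R + (k%:R - r%:R) * (r.-1)%:R)
  <= (homs (djunion (complete 'I_m) (sum_graph k r)))%:R :> R.
Proof.
move=> rk.
have sumc j (c : R) : j%:R * c = \sum_(i < j) c.
  by rewrite sumr_const card_ord mulr_natl.
rewrite homs_sum big_sumType /= card_sum !card_ord.
set n := (m + k)%:R; apply: lerD.
  rewrite [leLHS]sumc; apply: ler_sum => y _.
  rewrite big_sumType /= -[leLHS]add0r lerD//.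
    apply: sumr_ge0 => z _.
    rewrite !mulr_ge0// subr_ge0 /n ler_nat deg_djunion_l deg_complete card_ord; lia.
  rewrite [leLHS]sumc; apply: ler_sum => z _.
  rewrite adj_djunion_lr mulr1 deg_djunion_l deg_djunion_r deg_complete card_ord.
  have /andP[d1 d2] := deg_sum_graph z rk.
  apply: ler_pM => //; last by rewrite ler_nat.
  rewrite /n lerBrDr -natrD ler_nat; lia.
rewrite -mulrA [leLHS]sumc; apply: ler_sum => y _.
have /andP[d1 d2] := deg_sum_graph y rk.
have nr : 0 <= n - r%:R :> R by rewrite subr_ge0 ler_nat; lia.
have nd : n - r%:R <= n - (deg (djunion (complete 'I_m) (sum_graph k r)) (inr y))%:R :> R.
  by rewrite deg_djunion_r lerB// ler_nat.
rewrite big_sumType /= mulrDr lerD//.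
  rewrite mulrCA [leLHS]sumc.
  apply: ler_sum => z _.
  rewrite adj_djunion_rl mulr1 deg_djunion_l deg_complete card_ord.
  by rewrite ler_wpM2r.
apply: (@le_trans _ _ (\sum_z (n - r%:R) * (r.-1)%:R * (~~ adj (sum_graph k r) y z)%:R)).
  rewrite -mulr_sumr -natr_sum -mulrA ler_wpM2l// mulrC ler_wpM2l//.
  rewrite lerBlDr -natrD ler_nat.
  have : (\sum_z (~~ adj (sum_graph k r) y z) + deg (sum_graph k r) y = k)%N.
    rewrite degE -big_split /= -[RHS]card_ord -sum1_card; apply: eq_bigr => u _.
    by case: adj.
  lia.
apply: ler_sum => z _; rewrite adj_djunion_r mulrAC; apply: ler_pM => //.
- by rewrite !mulr_ge0.
- by rewrite ler_wpM2r.
- by rewrite deg_djunion_r ler_nat; have /andP[] := deg_sum_graph z rk.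
Qed.

(** * The limit *)
Local Open Scope classical_set_scope.
Local Open Scope ring_scope.

Section Upper.
Variables (R : realType) (x : R).
Hypothesis hx : cubic_root x.
Let a := clique_frac x.

Lemma homs_density_le_F (V : finType) (G : sgraph V) : (0 < #|V|)%N ->
  (homs G)%:R / #|V|%:R ^+ 4 <= F a x.
Proof.
move=> V0; rewrite homs_bbr//.
have xb := cubic_root_bounds hx; case: hx => [_ fx].
have ab : 74/123 < a < 68/113 := clique_frac_bounds xb.
pose b := gap x; have bb : 31/118 < b < 29/110 := gap_bounds xb.
move/andP: (xb) => [x1 x2]; move/andP: (ab) => [a1 a2]; move/andP: (bb) => [b1 b2].
apply: (@bbr_le _ _ _ _ _ V0 a x b) => //.
- by move=> u v; rewrite adjC.
- by move=> u v; rewrite ler0n lern1 leq_b1.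
- exact: light_stationary.
- exact: clique_stationary.
- exact: gap_sqr.
- lra.
- lra.
- by move=> m B t v; apply: deviation_form_ge0; rewrite ?subr_gt0; try apply/andP; try split; lra.
Qed.

(** The upper bound for a one-vertex graph, whose density is nonnegative. *)
Lemma F_ge0 : 0 <= F a x.
Proof.
apply: (le_trans _ (homs_density_le_F (complete 'I_1) _)); last by rewrite card_ord.
by rewrite mulr_ge0// invr_ge0 exprn_ge0.
Qed.

Lemma density_le_F (V : finType) (G : sgraph V) : density R H3 G <= F a x.
Proof.
have [V0|V0] := posnP #|V|.
  by rewrite /density V0 expr0n /= invr0 mulr0 F_ge0.
apply: le_trans (homs_density_le_F G V0).
by rewrite /density ler_wpM2r ?invr_ge0 ?exprn_ge0// ler_nat copies_le_homs.
Qed.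

Lemma max_density_le_F n : max_density R H3 n <= F a x.
Proof. by apply: bigmax_le => [|G _]; [exact: F_ge0|exact: density_le_F]. Qed.
End Upper.

Lemma density_ge_homs (R : realType) (V : finType) (G : sgraph V) : (0 < #|V|)%N ->
  (homs G)%:R / #|V|%:R ^+ 4 - 6 / #|V|%:R <= density R H3 G.
Proof.
move=> V0; have n0 : #|V|%:R != 0 :> R by rewrite pnatr_eq0 -lt0n.
rewrite lerBlDr /density.
have -> : 6 / #|V|%:R = (6 * #|V| ^ 3)%:R / #|V|%:R ^+ 4 :> R.
  by rewrite natrM natrX; field.
by rewrite -mulrDl -natrD ler_wpM2r ?invr_ge0 ?exprn_ge0// ler_nat homs_le_copies.
Qed.

Lemma cvg_ratio (R : realType) (C : R) (u : nat -> nat) (c : R) :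
  (forall n, `|(u n)%:R - c * n%:R| <= C) ->
  (u n)%:R / n%:R @[n --> \oo] --> c.
Proof.
move=> uc; apply/cvgrPdist_lt => e e0; near=> n.
have n0 : 0 < n%:R :> R by rewrite ltr0n; near: n; exact: nbhs_infty_gt.
rewrite distrC -(ltr_pM2r n0) -[X in _ * X](gtr0_norm n0) -normrM mulrBl divfK ?gt_eqF//.
apply: le_lt_trans (uc n) _.
rewrite mulrC -ltr_pdivrMr//; near: n; exact: nbhs_infty_gtr.
Unshelve. all: by end_near. Qed.

Section Extremal.
Variables (R : realType) (a x : R).
Hypotheses (a0 : 0 <= a) (x0 : 0 <= x) (ax : a + x <= 1).

Definition clique_size n := Num.truncn (a * n%:R).
Definition sparse_size n := (n - clique_size n)%N.
Definition sparse_deg n := Num.truncn (x * n%:R).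

Let m := clique_size.
Let k := sparse_size.
Let r := sparse_deg.

Lemma truncn_mul_itv (c : R) n : 0 <= c ->
  (Num.truncn (c * n%:R))%:R <= c * n%:R < (Num.truncn (c * n%:R))%:R + 1.
Proof. by move=> c0; rewrite natr1 truncn_itv ?mulr_ge0. Qed.

Lemma clique_sparse_sizes n : (m n + k n)%N = n.
Proof.
rewrite subnKC// -(ler_nat R).
have /andP[h _] := truncn_mul_itv n a0; apply: le_trans h _.
rewrite ler_piMl//. move: a0 x0 ax; lra.
Qed.

Lemma sparse_deg_le n : (r n <= k n)%N.
Proof.
have /andP[h _] := truncn_mul_itv n a0; have /andP[h' _] := truncn_mul_itv n x0.
have := clique_sparse_sizes n => /(congr1 (fun n => n%:R : R)).
rewrite natrD -(ler_nat R) => e.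
have : (a + x) * n%:R <= 1 * n%:R by rewrite ler_wpM2r.
rewrite /m /r /clique_size /sparse_deg in e *; lra.
Qed.

Lemma clique_size_cvg : (m n)%:R / n%:R @[n --> \oo] --> a.
Proof.
apply: (@cvg_ratio _ 2) => n; have := truncn_mul_itv n a0; rewrite /m /clique_size ler_norml; lra.
Qed.

Lemma clique_pred_cvg : (m n).-1%:R / n%:R @[n --> \oo] --> a.
Proof.
apply: (@cvg_ratio _ 2) => n; have := truncn_mul_itv n a0; rewrite /m /clique_size ler_norml.
by case: Num.truncn => [|j] /=; [|rewrite -(natr1 j)]; lra.
Qed.

Lemma sparse_size_cvg : (k n)%:R / n%:R @[n --> \oo] --> 1 - a.
Proof.
apply: (@cvg_ratio _ 2) => n; have := truncn_mul_itv n a0; rewrite /m /clique_size ler_norml.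
have := clique_sparse_sizes n => /(congr1 (fun n => n%:R : R)).
rewrite natrD; lra.
Qed.

Lemma sparse_deg_cvg : (r n)%:R / n%:R @[n --> \oo] --> x.
Proof.
apply: (@cvg_ratio _ 2) => n; have := truncn_mul_itv n x0; rewrite /r /sparse_deg ler_norml; lra.
Qed.

Lemma sparse_pred_cvg : (r n).-1%:R / n%:R @[n --> \oo] --> x.
Proof.
apply: (@cvg_ratio _ 2) => n; have := truncn_mul_itv n x0; rewrite /r /sparse_deg ler_norml.
by case: Num.truncn => [|j] /=; [|rewrite -(natr1 j)]; lra.
Qed.

Definition extremal n := djunion (complete 'I_(m n)) (sum_graph (k n) (r n)).

Lemma card_extremal n : #|{: 'I_(m n) + 'I_(k n)}| = n.
Proof. by rewrite card_sum !card_ord clique_sparse_sizes. Qed.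

(** Squeezing needs only a convergent lower bound, since [F a x] also bounds the
    density from above. *)
Lemma extremal_density_ge : exists f : nat -> R, f n @[n --> \oo] --> F a x /\
  forall n, (0 < n)%N -> f n <= density R H3 (extremal n).
Proof.
pose M n : R := (m n)%:R / n%:R.
pose M' n : R := (m n).-1%:R / n%:R.
pose K n : R := (k n)%:R / n%:R.
pose d n : R := (r n)%:R / n%:R.
pose d' n : R := (r n).-1%:R / n%:R.
exists (fun n => M n * (K n * (K n * d' n))
  + K n * (1 - d n) * (M n * M' n + (K n - d n) * d' n) - 6 / n%:R); split.
  have -> : F a x = a * ((1 - a) * ((1 - a) * x))
    + (1 - a) * (1 - x) * (a * a + (1 - a - x) * x) - 0.
    by rewrite /F; ring.
  apply: cvgB; last first.
    apply: (@cvg_ratio R 6 (fun=> 6%N)) => n.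
    by rewrite mul0r subr0 ger0_norm.
  have cM := clique_size_cvg; have cM' := clique_pred_cvg.
  have cK := sparse_size_cvg; have cd := sparse_deg_cvg; have cd' := sparse_pred_cvg.
  apply: cvgD; first by do !apply: cvgM.
  apply: cvgM; first by apply: cvgM => //; apply: cvgB => //; exact: cvg_cst.
  apply: cvgD; first exact: cvgM.
  by apply: cvgM => //; apply: cvgB.
move=> n n0; have := @density_ge_homs R _ (extremal n).
rewrite card_extremal => /(_ n0); apply: le_trans.
rewrite lerD2r.
have nn0 : n%:R != 0 :> R by rewrite pnatr_eq0 -lt0n.
have := homs_union_ge R (m n) (sparse_deg_le n).
rewrite clique_sparse_sizes => h.
have n4 : 0 <= (n%:R ^+ 4)^-1 :> R by rewrite invr_ge0 exprn_ge0.
apply: le_trans (ler_wpM2r n4 h).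
rewrite le_eqVlt; apply/orP; left; apply/eqP.
rewrite /M /M' /K /d /d'; by field.
Qed.

Lemma deg_extremal n (v : 'I_(k n)) :
  (r n)%:R - 1 <= ((deg (sum_graph (k n) (r n)) v)%:R : R) <= (r n)%:R.
Proof.
have /andP[h1 h2] := deg_sum_graph v (sparse_deg_le n).
rewrite lerBlDr natr1 !ler_nat h2 andbT; move: h1; rewrite -/(r n).
by case: (r n).
Qed.

Lemma deg_extremal_cvg eps : a < 1 -> 0 < eps -> \forall n \near \oo,
  forall v : 'I_(k n),
    `|(deg (sum_graph (k n) (r n)) v)%:R / n%:R - x| < eps /\
    `|(deg (sum_graph (k n) (r n)) v)%:R / (k n)%:R - x / (1 - a)| < eps.
Proof.
move=> a1 e0.
have cd := sparse_deg_cvg; have cK := sparse_size_cvg.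
have a1' : 1 - a != 0 by rewrite subr_eq0 gt_eqF.
have ci : 1%:R / n%:R @[n --> \oo] --> (0 : R).
  apply: (@cvg_ratio R 1 (fun=> 1%N)) => n.
  by rewrite mul0r subr0 ger0_norm.
have cl : (r n)%:R / n%:R / ((k n)%:R / n%:R) @[n --> \oo] --> x / (1 - a).
  by apply: cvgM => //; apply: cvgV.
have cj : 1%:R / n%:R / ((k n)%:R / n%:R) @[n --> \oo] --> (0 : R).
  by rewrite -[0](mul0r (1 - a)^-1); apply: cvgM => //; apply: cvgV.
have e2 : 0 < eps / 2 by rewrite divr_gt0.
near=> n => v.
have n0 : 0 < n%:R :> R by rewrite ltr0n; near: n; exact: nbhs_infty_gt.
have k0 : 0 < (k n)%:R :> R by rewrite ltr0n; apply: leq_ltn_trans (ltn_ord v).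
have := deg_extremal v; set D := (deg _ _)%:R => /andP[d1 d2].
(* Both quotients by [N] follow the same pattern, with [N = n] and [N = k n]. *)
have close (N c : R) : 0 < N -> `|c - (r n)%:R / N| < eps / 2 ->
    `|0 - 1%:R / N| < eps / 2 -> `|D / N - c| < eps.
  move=> N0; rewrite sub0r normrN !ltr_norml => /andP[h1 h2] /andP[h3 h4].
  have l1 : (r n)%:R / N - 1%:R / N <= D / N.
    by rewrite -mulrBl ler_pM2r ?invr_gt0.
  have l2 : D / N <= (r n)%:R / N by rewrite ler_pM2r ?invr_gt0.
  by apply/andP; split; lra.
have simp (y : R) : y / (k n)%:R = y / n%:R / ((k n)%:R / n%:R).
  by field; rewrite !gt_eqF.
split; apply: close => //; rewrite ?simp; near: n.
- by move/cvgrPdist_lt: cd; apply.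
- by move/cvgrPdist_lt: ci; apply.
- by move/cvgrPdist_lt: cl; apply.
- by move/cvgrPdist_lt: cj; apply.
Unshelve. all: by end_near. Qed.

End Extremal.

Theorem theorem1p1 (R : realType) :
  (exists! x : R, cubic_root x) /\
  forall x : R, cubic_root x ->
  let a := (4 * x ^+ 2 - 7 * x + 2) / (3 - 8 * x) in
  let lambda := x / (1 - a) in
  let p := F a x in
  [/\ cvgn (max_density R H3),
      inducibility R H3 = p &
      exists (m k : nat -> nat) (Rn : forall n, sgraph 'I_(k n)),
        [/\ forall n, (m n + k n)%N = n,
            (m n)%:R / n%:R @[n --> \oo] --> a,
            (k n)%:R / n%:R @[n --> \oo] --> 1 - a,
            (forall eps : R, 0 < eps -> \forall n \near \oo,
               forall v : 'I_(k n),
                 `|(deg (Rn n) v)%:R / n%:R - x| < eps /\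
                 `|(deg (Rn n) v)%:R / (k n)%:R - lambda| < eps) &
            density R H3 (djunion (complete 'I_(m n)) (Rn n))
              @[n --> \oo] --> p]].
Proof.
split.
  have [x hx] := cubic_root_exists R; exists x; split=> // y.
  exact: cubic_root_unique.
move=> x hx a lambda p.
have xb := cubic_root_bounds hx.
have ab : 74/123 < a < 68/113 := clique_frac_bounds xb.
have /andP[x1 x2] := xb; have /andP[a1 a2] := ab.
have x0 : 0 <= x by lra.
have a0 : 0 <= a by lra.
have ax : a + x <= 1 by lra.
have [f [fp fd]] := extremal_density_ge a0 x0 ax.
have dp : density R H3 (extremal a x n) @[n --> \oo] --> p.
  apply: (@squeeze_cvgr _ _ _ _ f (fun=> p)) => //; last exact: cvg_cst.
  near=> n; rewrite fd ?density_le_F//; near: n; exact: nbhs_infty_gt.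
have mp : max_density R H3 n @[n --> \oo] --> p.
  apply: (@squeeze_cvgr _ _ _ _ (fun n => density R H3 (extremal a x n))
    (fun=> p)) => //; last exact: cvg_cst.
  near=> n; rewrite max_density_le_F// andbT.
  by have := density_le_max R H3 (extremal a x n); rewrite (card_extremal a0 x0 ax).
split.
- exact: cvgP mp.
- exact: cvg_lim mp.
- exists (clique_size a), (sparse_size a).
  exists (fun n => sum_graph (sparse_size a n) (sparse_deg x n)); split.
  + exact: clique_sparse_sizes a0 x0 ax.
  + exact: clique_size_cvg.
  + exact: sparse_size_cvg a0 x0 ax.
  + move=> eps e0; apply: deg_extremal_cvg => //; lra.
  + exact: dp.
Unshelve. all: by end_near. Qed.
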